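(* For every infinite cardinal $\kappa$ there exists a $\kappa$-bounded regular topological space $X$ with a non-isolated point $x \in X$ that is discretely untouchable in $X$, i.e. $x$ is not an accumulation point of any discrete subset of $X$.
   Context: ''Regular'' includes the $T_1$ separation axiom (so regular spaces are Hausdorff). A space $X$ is called $\kappa$-bounded if every subset of $X$ of cardinality $\le \kappa$ has compact closure in $X$. A subset $D$ of $X$ is discrete if its subspace topology is discrete. A point $x\in X$ is an accumulation point of $A \subset X$ if every neighbourhood of $x$ contains a point of $A\setminus\{x\}$. A point $x$ is discretely touchable in $X$ if it is an accumulation point of some discrete subset of $X$, and discretely untouchable otherwise. *)

(* Defs.v *)
From mathcomp Require Import all_boot all_order all_algebra.
From mathcomp Require Import all_classical all_reals all_analysis.

Set Implicit Arguments.
Unset Strict Implicit.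
Unset Printing Implicit Defensive.

Local Open Scope classical_set_scope.
Local Open Scope card_scope.

(* The library's [regular_space] carries no separation of points. *)
Definition T1_regular_space (X : topologicalType) : Prop :=
  accessible_space X /\ regular_space X.

(* The cardinal kappa is the cardinality of the type [K]. *)
Definition cardinal_bounded (K : Type) (X : topologicalType) : Prop :=
  forall A : set X, A #<= [set: K] -> compact (closure A).

(* [set_type D] carries the subspace topology (initial for the inclusion);
   its being discrete is phrased as in [discreteTopologicalType]. *)
Definition discrete_subset (X : topologicalType) (D : set X) : Prop :=
  @nbhs (set_type D) (set_type D) = principal_filter.

Definition discretely_touchable (X : topologicalType) (x : X) : Prop :=
  exists2 D : set X, discrete_subset D & limit_point D x.

Definition discretely_untouchable (X : topologicalType) (x : X) : Prop :=
  ~ discretely_touchable x.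

(* Main.v *)
From HB Require Import structures.
Require Import Defs.
From mathcomp Require Import all_boot all_order all_algebra.
From mathcomp Require Import all_classical all_reals all_analysis.

Set Implicit Arguments.
Unset Strict Implicit.
Unset Printing Implicit Defensive.

Local Open Scope classical_set_scope.

(** Fix an index type [I] of size at least kappa. Take a tree of height kappa^+
    in which a node of height [i] has many more successors than there are
    ultrafilters on the set of nodes of height at most [i], together with a
    filter of "large" sets of successors that is complete enough for that
    number. Neighbourhoods of a branch are Laver-type subtrees: they follow the
    branch up to some stem and then restrict the successor of every node to a
    large set. The Laver-type subtrees with empty stem are the neighbourhoods of
    one more point, infinity. This is a space whose clopen sets are closed under
    intersections of size kappa, and X consists of the ultrafilters on it that
    contain a set of size at most kappa; it is zero-dimensional and
    kappa-bounded.

    Let D be discrete, infinity not in D. Each d in D contains a small set of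
    branches a_k with Laver-type neighbourhoods, all with stems of one height j,
    inside a clopen set W_d isolating d. For each j and each ultrafilter v on
    the nodes of height j choose one e in D of stem height j whose trace on
    these nodes is v. There are so few pairs (j, v) that a single tree B with
    empty stem lies below all the trees of these chosen e and avoids their
    branches. If d is in the closure of B, then the e chosen for (j, trace of d)
    has W_e in d, so d = e, but B avoids the branches of e. *)

(** * Brouwer ordinals, the heights of the tree *)

Inductive brouwer (A : Type) : Type :=
  | bzero : brouwer A
  | bsup : (A -> brouwer A) -> brouwer A.

Arguments bzero {A}.
Arguments bsup {A} f.

Section BrouwerOrder.
Variable A : Type.
Variable a0 : A.
Implicit Types s t r : brouwer A.

(* [ble] and [blt] compare ordinal ranks, so [bsup f] is a strict upper bound of
   [f] and [brouwer A] has no cofinal family indexed by [A]. *)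
Fixpoint ble s t : Prop :=
  match s with
  | bzero => True
  | bsup f => forall a, match t with
                        | bzero => False
                        | bsup g => exists b, ble (f a) (g b)
                        end
  end.

Definition blt s t : Prop :=
  match t with bzero => False | bsup g => exists b, ble s (g b) end.

Lemma ble_sup f t : ble (bsup f) t <-> forall a, blt (f a) t.
Proof. by []. Qed.

Lemma ble_trans r s t : ble r s -> ble s t -> ble r t.
Proof.
elim: r s t => [//|f IH] s t /ble_sup fs st; apply/ble_sup => a.
case: s st fs => [|g] st fs; first by case: (fs a).
have [b fg] := fs a; case: t st => [|h] st; first by case: (st b).
by have [c gh] := st b; exists c; exact: IH fg gh.
Qed.

Lemma blt_ble_trans r s t : blt r s -> ble s t -> blt r t.
Proof.
case: s => [[]|g] [b rg]; case: t => [|h] st; first by case: (st b).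
by have [c gh] := st b; exists c; exact: ble_trans gh.
Qed.

Lemma ble_refl s : ble s s.
Proof. by elim: s => [//|f IH] a; exists a; exact: IH. Qed.

Lemma bltW s t : blt s t -> ble s t.
Proof.
elim: s t => [//|f IH] [[]|g] [b sg]; apply/ble_sup => a.
by exists b; exact: IH (sg a).
Qed.

Lemma blt_sup f a : blt (f a) (bsup f).
Proof. by exists a; exact: ble_refl. Qed.

Lemma ble_total s t : (ble s t \/ blt t s) /\ (ble t s \/ blt s t).
Proof.
elim: s t => [|f IH] t.
  split; first by left.
  by case: t => [|g]; [left | right; exists a0].
split.
  have [fs|/existsNP[a nfs]] := pselect (forall a, blt (f a) t); first by left.
  by right; case: (IH a t) => _ [ta|//]; exists a.
case: t => [|g]; first by left.
have [gs|/existsNP[b ngs]] := pselect (forall b, blt (g b) (bsup f)).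
  by left.
right; exists b; apply/ble_sup => a.
have [gs|//] : ble (g b) (f a) \/ blt (f a) (g b) by case: (IH a (g b)).
by case: ngs; exists a.
Qed.

Lemma nblt_ble s t : ~ blt s t -> ble t s.
Proof. by case: (ble_total s t) => _ []. Qed.

Lemma blt_wf : well_founded blt.
Proof.
move=> t; suff : forall s, ble s t -> Acc blt s by apply; exact: ble_refl.
elim: t => [|g IH] s st; constructor=> r rs.
  by case: (blt_ble_trans rs st).
by have [b rg] := blt_ble_trans rs st; exact: IH rg.
Qed.

Lemma blt_irr s : ~ blt s s.
Proof.
by elim/(well_founded_ind blt_wf): s => s IH ss; exact: (IH s ss ss).
Qed.

End BrouwerOrder.

(** Each level of the tree is built from all lower ones. [Fix] unfolds only up to propositional
    equality, hence the equation between types. *)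
Lemma exists_tower (J : Type) (lt : J -> J -> Prop) (G : J -> Type -> Type) :
  well_founded lt ->
  exists T : J -> Type, forall i, T i = brouwer (G i (forall l, lt l i -> T l)).
Proof.
move=> wf; pose step i (rec : forall l, lt l i -> Type) : Type :=
  brouwer (G i (forall l (h : lt l i), rec l h)).
exists (Fix wf (fun=> Type) step) => i.
rewrite (Fix_eq wf (fun=> Type) step) // => j f g fg.
congr step; apply: functional_extensionality_dep => l.
by apply: functional_extensionality_dep => h; exact: fg.
Qed.

(** * Zero-dimensional spaces of small ultrafilters *)

Record clopen_field (I Q : Type) := ClopenField {
  clo : set (set Q);
  cloC : forall A, clo A -> clo (~` A);
  cloI : forall A B, clo A -> clo B -> clo (A `&` B);
  clo_bigcap : forall f : I -> set Q,
    (forall i, clo (f i)) -> clo (\bigcap_i f i);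
  cloT : clo setT;
  clo_sep : forall x y, x <> y -> exists2 W, clo W & W x /\ ~ W y }.

(** The ultrafilters live on all subsets of [Q], the topology only on the field; [clo_sep_small] is
    what makes the field separate them. *)
Definition ultra_space (I Q : Type) (F : clopen_field I Q) : Type :=
  {u : set (set Q) | UltraFilter u /\ exists f : I -> Q, u (range f)}.

HB.instance Definition _ I Q (F : clopen_field I Q) :=
  gen_eqMixin (ultra_space F).
HB.instance Definition _ I Q (F : clopen_field I Q) :=
  gen_choiceMixin (ultra_space F).

Section UltraSpace.
Variables (I Q : Type) (F : clopen_field I Q).
Implicit Types x y : ultra_space F.

Definition ultra_in (W : set Q) : set (ultra_space F) := [set x | sval x W].

#[global] Instance ultra_space_ultra x : UltraFilter (sval x).
Proof. by case: x => u []. Qed.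

Lemma ultra_spaceP x y : (forall W, sval x W -> sval y W) -> x = y.
Proof.
move=> xy; apply: eq_sig_hprop; first by move=> ? *; exact: Prop_irrelevance.
symmetry.
by apply: (@max_filter _ (sval x)) => W; exact: xy.
Qed.

Lemma ultra_inC W : ultra_in (~` W) = ~` ultra_in W.
Proof.
apply/seteqP; split=> x /= xW.
  by move=> xW'; apply: (@filter_not_empty _ (sval x)); rewrite -(setICr W);
    exact: filterI.
by case: (in_ultra_setVsetC W (ultra_space_ultra x)).
Qed.

Definition ultra_open : set (set (ultra_space F)) :=
  [set U | forall x, U x -> exists2 W, clo F W & sval x W /\ ultra_in W `<=` U].

Let ultra_openT : ultra_open setT.
Proof.
by move=> x _; exists setT; [exact: cloT | split => //; exact: filterT].
Qed.

Let ultra_openI : setI_closed ultra_open.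
Proof.
move=> U V Uo Vo x [/Uo[A FA [xA AU]] /Vo[B FB [xB BV]]].
exists (A `&` B); first exact: cloI.
split=> [|y yAB]; first exact: filterI.
by split; [apply: AU | apply: BV]; apply: filterS yAB => z [].
Qed.

Let ultra_open_bigU (J : Type) (f : J -> set (ultra_space F)) :
  (forall i, ultra_open (f i)) -> ultra_open (\bigcup_i f i).
Proof.
move=> fo x [i _ /(fo i)[W FW [xW Wf]]].
by exists W => //; split=> // y /Wf fy; exists i.
Qed.

HB.instance Definition _ := isOpenTopological.Build (ultra_space F)
  ultra_openT ultra_openI ultra_open_bigU.

Lemma ultra_openE U : open U = ultra_open U.
Proof. by []. Qed.

Lemma open_ultra_in W : clo F W -> open (ultra_in W).
Proof. by move=> FW; rewrite ultra_openE => x xW; exists W => //; split. Qed.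

Lemma closed_ultra_in W : clo F W -> closed (ultra_in W).
Proof.
by move=> FW; rewrite -[W]setCK ultra_inC; apply: open_closedC;
  apply: open_ultra_in; exact: cloC.
Qed.

Lemma nbhs_ultra x U :
  nbhs x U <-> exists2 W, clo F W & sval x W /\ ultra_in W `<=` U.
Proof.
split=> [|[W FW [xW WU]]].
  rewrite nbhsE => -[V [Vo Vx] VU].
  move: Vo; rewrite ultra_openE => /(_ x Vx)[W FW [xW WV]].
  by exists W => //; split=> //; exact: subset_trans VU.
by rewrite nbhsE; exists (ultra_in W) => //; split=> //; exact: open_ultra_in.
Qed.

(* Each point outside [B] is separated from all of [B] by an intersection of
   [I] members of [F]; a union of [I] such members separates [A] from [B]. *)
Lemma clo_sep_small (f g : I -> Q) (S : set Q) :
  exists2 W, clo F W & range f `&` S `<=` W /\ range g `&` ~` S `<=` ~` W.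
Proof.
have sep q r : exists2 W, clo F W & S q -> ~ S r -> W q /\ ~ W r.
  have [->|/(clo_sep F)[W FW Wqr]] := pselect (q = r).
    by exists setT => //; exact: cloT.
  by exists W.
pose w q r : set Q := s2val (cid2 (sep q r)).
have Fw q r : clo F (w q r) by rewrite /w; case: cid2.
have wP q r : S q -> ~ S r -> w q r q /\ ~ w q r r.
  by rewrite /w; case: cid2.
pose w1 q := \bigcap_i if `[< S (g i) >] then setT else w q (g i).
have Fw1 q : clo F (w1 q).
  by apply: clo_bigcap => i; case: asboolP => _; [exact: cloT|exact: Fw].
pose w2 := \bigcap_i if `[< S (f i) >] then ~` w1 (f i) else setT.
exists (~` w2).
  apply: cloC; apply: clo_bigcap => i.
  by case: asboolP => _; [exact/cloC/Fw1|exact: cloT].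
split=> [_ [[i _ <-] Sfi] w2f|_ [[i _ <-] Sgi]].
  have := w2f i Logic.I; case: asboolP => //= _; apply => j _.
  by case: asboolP => //= Sgj; case: (wP _ _ Sfi Sgj).
rewrite setCK => j _; case: asboolP => //= Sfj w1g.
have := w1g i Logic.I; case: asboolP => //= _.
by case: (wP _ _ Sfj Sgi).
Qed.

Lemma ultra_sep x y : x <> y -> exists2 W, clo F W & sval x W /\ ~ sval y W.
Proof.
move=> xy.
have [S xS nyS] : exists2 S, sval x S & ~ sval y S.
  apply: contrapT => no; apply: xy; apply: ultra_spaceP => S xS.
  by apply: contrapT => nyS; apply: no; exists S.
have [f xf] : exists f : I -> Q, sval x (range f) by case: (x) => u [].
have [g yg] : exists f : I -> Q, sval y (range f) by case: (y) => u [].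
have [W FW [fW gW]] := clo_sep_small f g S.
exists W => //; split; first by apply: filterS fW _; exact: filterI.
have : ultra_in (~` W) y.
  apply: filterS gW _; apply: filterI => //.
  by have : (~` ultra_in S) y by []; rewrite -ultra_inC.
by rewrite ultra_inC.
Qed.

Lemma ultra_hausdorff : hausdorff_space (ultra_space F).
Proof.
move=> x y xy; apply: contrapT => /ultra_sep[W FW [xW yW]].
have [||z [zW]] := xy (ultra_in W) (ultra_in (~` W)).
- by apply/nbhs_ultra; exists W => //; split.
- apply/nbhs_ultra; exists (~` W); first exact: cloC.
  by split=> //; have : (~` ultra_in W) y by []; rewrite -ultra_inC.
- by rewrite ultra_inC.
Qed.

Lemma ultra_regular : T1_regular_space (ultra_space F).
Proof.
split; first exact/hausdorff_accessible/ultra_hausdorff.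
move=> x U /nbhs_ultra[W FW [xW WU]].
exists (ultra_in W); first by apply/nbhs_ultra; exists W => //; split.
by move/closure_id: (closed_ultra_in FW) => <-.
Qed.

(* Any ultrafilter on the set of points containing a fixed [range f] converges
   to its limit, which is again an ultrafilter on [Q] containing [range f]. *)
Lemma ultra_in_compact (f : I -> Q) : compact (ultra_in (range f)).
Proof.
rewrite compact_ultra => G UG Gf.
pose w : set (set Q) := [set S | G (ultra_in S)].
have wF : ProperFilter w.
  split; rewrite /w /=.
    move=> w0; apply: (@filter_not_empty _ G); apply: filterS w0 => x xS.
    by exfalso; apply: (@filter_not_empty _ (sval x)).
  apply: Build_Filter => /=.
  - by apply: filterS filterT => x _; exact: filterT.
  - move=> S T; apply: (@filterS2 _ G) => x xS xT; exact: filterI.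
  - move=> S T ST; apply: (@filterS _ G) => x; exact: filterS.
have wU : UltraFilter w.
  split=> // H HF wH; apply/seteqP; split=> // S HS.
  have [//|] := in_ultra_setVsetC (ultra_in S) UG.
  rewrite -ultra_inC => /wH HS'; exfalso.
  by apply: (@filter_not_empty _ H); rewrite -(setICr S); exact: filterI.
have wP : UltraFilter w /\ exists f : I -> Q, w (range f).
  by split=> //; exists f.
exists (exist _ w wP); split=> //= U /nbhs_ultra[W FW [wW WU]].
exact: (@filterS _ G _ (ultra_in W)).
Qed.

(** Each point of [A] contains some range; through [s] the union of these ranges is again a single
    range, and the closure of [A] stays in the compact set it defines. *)
Lemma ultra_bounded (K : Type) (s : I -> option K * I) :
  (forall p, exists i, s i = p) -> cardinal_bounded K (ultra_space F).
Proof.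
move=> s_surj A A_le.
have [->|/set0P[x0 Ax0]] := eqVneq A set0.
  by rewrite closure0; exact: compact0.
pose X0 := HB.pack_for pointedType (ultra_space F)
  (isPointed.Build (ultra_space F) x0).
have /(@pcard_surjP X0)[g gA] := A_le.
pose g' o := if o is Some k then g k else x0.
have /choice[f fP] o : exists f : I -> Q, sval (g' o : ultra_space F) (range f).
  by case: (g' o) => u [].
pose h i := f (s i).1 (s i).2.
have h_compact := @ultra_in_compact h.
suff Ah : closure A `<=` ultra_in (range h).
  have A_compact :=
    @subclosed_compact _ _ _ (@closed_closure _ A) h_compact Ah.
  exact: A_compact.
rewrite closureE; apply: smallest_sub.
  exact: compact_closed ultra_hausdorff h_compact.
move=> x /gA[k _ <-]; apply: filterS (fP (Some k)) => _ [i _ <-].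
by have [j sj] := s_surj (Some k, i); exists j => //; rewrite /h sj.
Qed.

End UltraSpace.

(** * The levels of the tree and their filters of large sets *)

Definition seg (I : Type) (T : brouwer I -> Type) (i : brouwer I) : Type :=
  forall l, blt l i -> T l.

(* An element of [code i E] names a height [j], a family of sets of branches up
   to height [i] (the trace of an ultrafilter), and one of two objects attached
   to an index of [I]. *)
Definition code (I : Type) (i : brouwer I) (E : Type) : Type :=
  (brouwer I * set (set E) * (bool * I))%type.

(* [lev i] is the set of successors of any node of height [i]; the sets [dom t]
   generate the filter of large sets, and [tsup] is its completeness. *)
Record tower (I : Type) := Tower {
  lev : brouwer I -> Type;
  bot : forall i, lev i;
  dom : forall i, lev i -> lev i -> Prop;
  tsup : forall i, (code i (seg lev i) -> lev i) -> lev i;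
  dom_refl : forall i (x : lev i), dom x x;
  dom_tsup : forall i (g : code i (seg lev i) -> lev i) c x,
    dom (tsup g) x -> dom (g c) x;
  tsup_neq : forall i (g : code i (seg lev i) -> lev i) c x,
    dom (tsup g) x -> x <> g c }.

Lemma tower_inhabited (I : Type) (i0 : I) : inhabited (tower I).
Proof.
have [T TE] := @exists_tower _ _ (@code I) (@blt_wf I).
(* Stating this for any [S] equal to [brouwer A] lets the equation [TE i] be eliminated by
   rewriting. *)
have dominance (A S : Type) : A -> S = brouwer A ->
    exists p : S * (S -> S -> Prop) * ((A -> S) -> S),
    [/\ forall x, p.1.2 x x, forall g c x, p.1.2 (p.2 g) x -> p.1.2 (g c) x &
        forall g c x, p.1.2 (p.2 g) x -> x <> g c].
  move=> a0 ->; exists (bzero, @ble A, bsup); split=> /=; first exact: ble_refl.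
    by move=> g c x gx; exact: bltW (gx c).
  by move=> g c _ /[swap] -> gx; exact: blt_irr (gx c).
have c0 i : code i (seg T i) by exact: (bzero, set0, (true, i0)).
pose ps i := cid (dominance _ _ (c0 i) (TE i)).
split; apply: (@Tower I T (fun i => (projT1 (ps i)).1.1)
  (fun i => (projT1 (ps i)).1.2) (fun i => (projT1 (ps i)).2)) => i;
  by case: (projT2 (ps i)).
Qed.

(** * The topology on the branches and infinity *)

Section BranchSpace.
Variables (I : Type) (T : tower I) (s : I -> bool).
Hypothesis s_surj : forall o, exists i, s i = o.
Let J := brouwer I.
Implicit Types i j l : J.

Definition point := forall i, lev T i.
Definition res i (x : point) : seg (lev T) i := fun l _ => x l.
Arguments res i x : clear implicits.
Definition constraint := forall i, seg (lev T) i -> lev T i.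
Implicit Types (x y z : point) (b : constraint).

Definition obeys b i y := dom (b i (res i y)) (y i).

(* The first disjunct keeps [x] itself in its cones, whatever [b] is. *)
Definition cone x j b : set point :=
  [set y | res j y = res j x /\
    forall i, ~ blt i j -> (res i y = res i x /\ y i = x i) \/ obeys b i y].

Lemma resP i x y : res i x = res i y <-> forall l, blt l i -> x l = y l.
Proof.
split=> [xy l li|xy]; first by have := f_equal (fun E => E l li) xy.
apply: functional_extensionality_dep => l.
by apply: functional_extensionality_dep => li; exact: xy.
Qed.

Lemma index_inhabited : inhabited I.
Proof. by have [i _] := s_surj true; split. Qed.

Lemma res_le i j x y : ~ blt i j -> res i x = res i y -> res j x = res j y.
Proof.
have [i0] := index_inhabited.
move=> /(nblt_ble i0) ji /resP xy; apply/resP => l lj.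
by apply: xy; exact: blt_ble_trans ji.
Qed.

(** Completeness of the filter for families indexed by [I], which a code carries in its last
    component. *)
Definition isup i (g : I -> lev T i) : lev T i := tsup (fun c => g c.2.2).

Lemma dom_isup i (g : I -> lev T i) k t : dom (isup g) t -> dom (g k) t.
Proof. exact: (@dom_tsup _ _ _ _ (bzero, set0, (true, k))). Qed.

Lemma isup_neq i (g : I -> lev T i) k t : dom (isup g) t -> t <> g k.
Proof. exact: (@tsup_neq _ _ _ _ (bzero, set0, (true, k))). Qed.

(* [None] is the point at infinity, to be made discretely untouchable. *)
Definition branch_open (W : set (option point)) : Prop :=
  (forall x, W (Some x) ->
    exists j b, forall y, cone x j b y -> W (Some y)) /\
  (W None -> exists b, forall y, (forall i, obeys b i y) -> W (Some y)).

Lemma cone_sub x j j' b : ble j j' -> cone x j' b `<=` cone x j b.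
Proof.
move=> jj' y [yx yb]; split=> [|i nij].
  move/resP: yx => yx; apply/resP => l lj.
  by apply: yx; exact: blt_ble_trans jj'.
have [ij'|nij'] := pselect (blt i j'); last exact: yb.
left; move/resP: yx => yx; split; last exact: yx.
by apply/resP => l li; apply: yx; exact: blt_ble_trans (bltW ij').
Qed.

(* The heights [j] are bounded because [J] has no [I]-indexed cofinal family. *)
Lemma cones_bound (W : set (option point)) (a : I -> point) :
  branch_open W -> (forall k, W (Some (a k))) ->
  exists j (b : I -> constraint), forall k y,
    cone (a k) j (b k) y -> W (Some y).
Proof.
move=> [Wo _] Wa.
have /choice[jb jbP] k : exists p : J * constraint,
    forall y, cone (a k) p.1 p.2 y -> W (Some y).
  by have [j [b jbW]] := Wo _ (Wa k); exists (j, b).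
exists (bsup (fun k => (jb k).1)), (fun k => (jb k).2) => k y ya.
by apply: (jbP k); apply: cone_sub ya; apply: bltW; exact: blt_sup.
Qed.

(** [bsup] bounds the stem heights and [isup] combines the constraints, for [I] many sets at
    once. *)
Lemma branch_open_bigcap (f : I -> set (option point)) :
  (forall k, branch_open (f k)) -> branch_open (\bigcap_k f k).
Proof.
move=> fo; split=> [x xf|Nf].
  have /choice[jb jbP] k : exists p : J * constraint,
      forall y, cone x p.1 p.2 y -> f k (Some y).
    by have [j [b jbf]] := (fo k).1 _ (xf k Logic.I); exists (j, b).
  exists (bsup (fun k => (jb k).1)).
  exists (fun i E => isup (fun k => (jb k).2 i E)) => y [yx yb] k _.
  apply: (jbP k); apply: (@cone_sub _ _ (bsup (fun k => (jb k).1))).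
    by apply: bltW; exact: (blt_sup (fun k => (jb k).1)).
  split=> // i /yb[|/dom_isup yk]; first by left.
  by right; exact: yk.
have /choice[b bP] k :
    exists b, forall y, (forall i, obeys b i y) -> f k (Some y).
  exact: (fo k).2 (Nf k Logic.I).
exists (fun i E => isup (fun k => b k i E)) => y yb k _.
by apply: bP => i; exact: dom_isup (yb i).
Qed.

Lemma branch_open_bigcup (f : I -> set (option point)) :
  (forall k, branch_open (f k)) -> branch_open (\bigcup_k f k).
Proof.
move=> fo; split=> [x [k _ /((fo k).1 _)[j [b jb]]]|[k _ /((fo k).2)[b bf]]].
  by exists j, b => y /jb; exists k.
by exists b => y /bf; exists k.
Qed.

Lemma branch_openT : branch_open setT.
Proof.
by split=> [x _|_]; [exists bzero|]; exists (fun i _ => bot T i).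
Qed.

Definition branch_clopen : set (set (option point)) :=
  [set W | branch_open W /\ branch_open (~` W)].

Lemma branch_clopenC W : branch_clopen W -> branch_clopen (~` W).
Proof. by move=> [Wo Wc]; split=> //; rewrite setCK. Qed.

Lemma branch_clopen_bigcap (f : I -> set (option point)) :
  (forall k, branch_clopen (f k)) -> branch_clopen (\bigcap_k f k).
Proof.
move=> fo; split; first by apply: branch_open_bigcap => k; case: (fo k).
by rewrite setC_bigcap; apply: branch_open_bigcup => k; case: (fo k).
Qed.

Lemma branch_clopenI A B :
  branch_clopen A -> branch_clopen B -> branch_clopen (A `&` B).
Proof.
move=> Ao Bo.
have -> : A `&` B = \bigcap_k (if s k then A else B).
  apply/seteqP; split=> [x [Ax Bx] k _|x AB]; first by case: (s k).
  by split; [have [k sk] := s_surj true | have [k sk] := s_surj false];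
    have := AB k Logic.I; rewrite sk.
by apply: branch_clopen_bigcap => k; case: (s k).
Qed.

Lemma branch_clopenT : branch_clopen setT.
Proof. by split; [exact: branch_openT | rewrite setCT]. Qed.

Definition slice i x : set (option point) :=
  [set o | if o is Some y then y i = x i else False].

(** A stem reaching past height [i] decides membership of a branch; near infinity the constraint [b]
    forbids the value [x i]. *)
Lemma slice_clopen i x : branch_clopen (slice i x).
Proof.
have [i0] := index_inhabited.
have cone_i z b y : cone z (bsup (fun=> i)) b y -> y i = z i.
  by move=> [/resP-> //]; exact: (blt_sup (fun=> i) i0).
pose b i (_ : seg (lev T) i) := isup (fun=> x i).
split; split=> //.
- by move=> z /= zx; exists (bsup (fun=> i)), b => y /cone_i ->.
- by move=> z /= zx; exists (bsup (fun=> i)), b => y /cone_i ->.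
by move=> _; exists b => y yb /=; exact: isup_neq i0 _ (yb i).
Qed.

Definition branch_field : clopen_field I (option point).
Proof.
apply: (@ClopenField I _ branch_clopen); [exact: branch_clopenC
  | exact: branch_clopenI | exact: branch_clopen_bigcap
  | exact: branch_clopenT |].
have neq x y : x <> y -> exists i, y i <> x i.
  move=> xy; apply: contrapT => /forallNP no; apply: xy.
  apply: functional_extensionality_dep => i; apply: contrapT => yx.
  exact: no i (nesym yx).
move=> [x|] [y|] // xy.
- have [i yx] : exists i, y i <> x i by apply: neq => xE; apply: xy; rewrite xE.
  by exists (slice i x); [exact: slice_clopen|].
- by exists (slice bzero x); [exact: slice_clopen|split].
- exists (~` slice bzero y); first exact/branch_clopenC/slice_clopen.
  by split=> //; apply.
Defined.

Definition large b : set (option point) :=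
  [set o | if o is Some y then forall i, obeys b i y else True].

Lemma large_clopen b : branch_clopen (large b).
Proof.
have [i0] := index_inhabited.
split; split=> //.
- move=> z /= zb; exists bzero, b => y [_ yb] i /=.
  by have [[yz yi]|//] := yb i (fun h => h); rewrite /obeys yz yi; exact: zb.
- by move=> _; exists b.
2: by move=> /(_ Logic.I).
(* Disobedience at [i] is visible on the branch up to and including [i], so a stem of height [i + 1]
   preserves it. *)
move=> z /= /existsNP[i zb]; exists (bsup (fun=> i)), b => y [yz _] /= yb.
apply: zb; have := yb i; rewrite /obeys.
have iS : blt i (bsup (fun=> i)) by exact: (blt_sup (fun=> i) i0).
move/resP: (yz) => -> //; rewrite (res_le _ yz) // => Si.
exact: blt_irr (blt_ble_trans iS (bltW Si)).
Qed.

(** The branch that always takes the value given by [b] itself obeys by [dom_refl]. Hence every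
    neighbourhood of infinity contains branches. *)
Lemma obeys_all b : exists y, forall i, obeys b i y.
Proof.
pose y := Fix (@blt_wf I) (lev T) b.
exists y => i; rewrite /obeys /y Fix_eq; first exact: dom_refl.
move=> j f g fg; congr b.
apply: functional_extensionality_dep => l.
by apply: functional_extensionality_dep => h; exact: fg.
Qed.

Let X := ultra_space branch_field.

Lemma principal_inh (o : option point) :
  UltraFilter (principal_filter o) /\
  exists f : I -> option point, principal_filter o (range f).
Proof.
have [i0] := index_inhabited.
split; first exact: principal_filter_ultra.
by exists (fun=> o); apply/principal_filterP; exists i0.
Qed.

Definition at_point (o : option point) : X := exist _ _ (principal_inh o).

Lemma at_pointE o (A : set (option point)) : sval (at_point o) A <-> A o.
Proof. exact: principal_filterP. Qed.

Lemma infinity_not_isolated : ~ isolated [set: X] (at_point None).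
Proof.
move=> [_ [V /nbhs_ultra[W [[_ WN] _] [/at_pointE NW WV]]]].
have [b bW] := WN NW; have [y yb] := obeys_all b.
rewrite setIT => VE.
have : V (at_point (Some y)) by apply: WV; apply/at_pointE; exact: bW.
rewrite VE => /(f_equal sval) yN.
have : sval (at_point None) [set None] by exact/at_pointE.
by rewrite -yN => /at_pointE.
Qed.

(** * Traces and the untouchability of infinity *)

Definition saturated j (P : set point) : Prop :=
  forall x y, res j x = res j y -> P x -> P y.

Definition trace j (d : X) : set (set point) :=
  [set P | saturated j P /\ sval d (Some @` P)].

Definition decode i (V : set (set (seg (lev T) i))) : set (set point) :=
  [set P | exists2 S, V S & P = [set z | S (res i z)]].

(** A code at height [i] speaks only of initial segments below [i]. A set saturated at [j] is also
    saturated at [i], so it is the preimage of a set of such segments. *)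
Lemma trace_decode i j d : ~ blt i j ->
  exists V : set (set (seg (lev T) i)), decode V = trace j d.
Proof.
move=> nij; exists [set S | trace j d [set z | S (res i z)]].
apply/seteqP; split=> [P [S SP ->]//|P Pd].
have PE : P = [set z | exists2 z', P z' & res i z' = res i z].
  apply/seteqP; split=> [z Pz|z [z' Pz' zz]]; first by exists z.
  exact: Pd.1 (res_le nij zz) Pz'.
by exists [set E | exists2 z', P z' & res i z' = E] => //=; rewrite -PE.
Qed.

#[local] Instance X_ultra (d : X) : UltraFilter (sval d) :=
  @ultra_space_ultra _ _ branch_field d.

Lemma isolating_cones (d : X) W : d <> at_point None ->
  branch_clopen W -> sval d W ->
  exists j (a : I -> point) (b : I -> constraint),
    sval d (range (Some \o a)) /\
    forall k y, cone (a k) j (b k) y -> W (Some y).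
Proof.
move=> dN [Wo _] dW.
have [f df] : exists f : I -> option point, sval d (range f).
  by case: (d) => u [].
have dnN : sval d (~` [set None]).
  have [dN'|//] := in_ultra_setVsetC [set None] (X_ultra d).
  exfalso; apply: dN; symmetry; apply: ultra_spaceP => A /at_pointE AN.
  by apply: filterS dN' => _ ->.
have dA : sval d (range f `&` (W `&` ~` [set None])).
  by apply: filterI => //; exact: filterI.
have [y0 Wy0] : exists y, W (Some y).
  by have [[y|] [_ [Wy]]] := filter_ex dA; [exists y|case].
(* The default [y0] replaces infinity and branches outside [W], as [cones_bound] needs every [a k]
   in [W]. *)
have /choice[a aP] k : exists y, W (Some y) /\
    forall y', W (f k) -> f k = Some y' -> y = y'.
  case fk: (f k) => [y|]; last by exists y0.
  have [Wy|nWy] := pselect (W (Some y)); last by exists y0.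
  by exists y; split=> // y' _ [].
have [j [b bW]] := cones_bound Wo (fun k => (aP k).1).
exists j, a, b; split=> //.
apply: filterS dA => _ [[k _ <-]] [].
case fk: (f k) => [y|] Wy; last by case.
move=> _; exists k => //=.
by congr Some; apply: (aP k).2; rewrite ?fk.
Qed.

Lemma infinity_untouchable : discretely_untouchable (at_point None).
Proof.
move=> [D D_discrete D_lim].
pose D' d := D d /\ d <> at_point None.
have [i0] := index_inhabited.
have /choice[m mP] (d : X) :
    exists p : set (option point) * J * (I -> point) * (I -> constraint),
    D' d ->
    [/\ sval d (range (Some \o p.1.2)),
      forall k y, cone (p.1.2 k) p.1.1.2 (p.2 k) y -> p.1.1.1 (Some y) &
      forall e, D e -> sval e p.1.1.1 -> e = d].
  have [[Dd dN]|nd] := pselect (D' d); last first.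
    by exists (set0, bzero, (fun=> bot T), (fun _ i _ => bot T i)).
  have : nbhs (SigSub (mem_set Dd) : set_type D) [set SigSub (mem_set Dd)].
    by rewrite D_discrete; exact/principal_filterP.
  move=> [_ [[U Uo <-] /= Ud] UD].
  have /nbhs_ultra[W FW [dW WU]] : nbhs d U by exact: open_nbhs_nbhs.
  have [j [a [b [da bW]]]] := isolating_cones dN FW dW.
  exists (W, j, a, b) => _; split=> //= e De eW.
  by have /(f_equal val) := UD (SigSub (mem_set De)) (WU _ eW).
pose Wd d := (m d).1.1.1; pose jd d := (m d).1.1.2.
pose ad d := (m d).1.2; pose bd d := (m d).2.
have /choice[rep repP] (q : J * set (set point)) : exists e, forall d,
    D' d -> jd d = q.1 -> trace q.1 d = q.2 ->
    [/\ D' e, jd e = q.1 & trace q.1 e = q.2].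
  have [[d [Dd dq tq]]|no] :=
    pselect (exists d, [/\ D' d, jd d = q.1 & trace q.1 d = q.2]).
    by exists d.
  by exists (at_point None) => d Dd dq tq; exfalso; apply: no; exists d.
pose b : constraint := fun i E => tsup (fun c : code i (seg (lev T) i) =>
  let e := rep (c.1.1, decode c.1.2) in
  if c.2.1 then bd e c.2.2 i E else ad e c.2.2 i).
have : nbhs (at_point None) (ultra_in (large b)).
  apply/nbhs_ultra; exists (large b); first exact: large_clopen.
  by split=> //; exact/at_pointE.
move=> /D_lim[d [/eqP dN Dd d_large]].
have Dd' : D' d by [].
pose j := jd d; pose e := rep (j, trace j d).
have [De je te] := repP (j, trace j d) d Dd' erefl erefl.
have bP i y k : ~ blt i j -> obeys b i y ->
    dom (bd e k i (res i y)) (y i) /\ y i <> ad e k i.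
  move=> /(@trace_decode i j d)[V VE] yb; split.
    by have := @dom_tsup _ _ _ _ (j, V, (true, k)) _ yb; rewrite /= VE.
  by have := @tsup_neq _ _ _ _ (j, V, (false, k)) _ yb; rewrite /= VE.
have [ea eW eD] := mP e De.
have eWd : sval d (Wd e).
  (* Branches sharing their node of height [j] with some [ad e k]. [P] is in the trace of [e], hence
     in that of [d]; this supplies the stem, and [b] takes over from height [j] on. *)
  pose P := [set y | exists k, res j (ad e k) = res j y].
  have : trace j e P.
    split=> [x y xy [k kx]|]; first by exists k; rewrite kx.
    by apply: filterS ea => _ [k _ <-]; exists (ad e k) => //; exists k.
  rewrite te => -[_ dP].
  apply: filterS (filterI d_large dP) => _ [/[swap] -[y [k ky] <-] yb].
  apply: (eW k); rewrite -/(jd e) je; split=> // i nij; right.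
  by have [] := bP i y k nij (yb i).
have de := eD _ Dd eWd.
rewrite -de in ea.
(* As [d = e], some [ad e k] obeys [b], which at height [j] makes it differ from itself. *)
have [_ [[k _ <-] /(_ j) kb]] := filter_ex (filterI ea d_large).
by have [_] := bP j _ k (@blt_irr _ j) kb; rewrite -de.
Qed.

End BranchSpace.

Unset Implicit Arguments.

Theorem mainTheorem1 :
  forall K : Type, infinite_set [set: K] ->
  exists X : topologicalType,
    [/\ T1_regular_space X,
        cardinal_bounded K X &
        exists x : X, ~ isolated [set: X] x /\ discretely_untouchable x].
Proof.
move=> K K_infinite.
have [k0 _] := infinite_setN0 K_infinite.
(* Sequences absorb one more entry: splitting off the first maps [I] onto [option K * I]. *)
pose I := nat -> option K.
have s_surj o : exists h : I, isSome (h 0%N) = o.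
  by exists (fun=> if o then Some k0 else None); case: o.
have [T] := tower_inhabited ((fun=> None) : I).
exists (ultra_space (branch_field T s_surj)); split.
- exact: ultra_regular.
- apply: (@ultra_bounded _ _ _ _ (fun h => (h 0%N, fun n => h n.+1))).
  by move=> [q h]; exists (fun n => if n is m.+1 then h m else q).
- by exists (at_point s_surj None); split;
    [exact: infinity_not_isolated | exact: infinity_untouchable].
Qed.
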